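(* Let $G$ be a finitely generated group, $S$ a finite generating set of $G$, and $\Gamma=\Gamma(G,S)$ its Cayley graph. Then the following are equivalent: (i) $\Gamma$ cannot be traversed by a collective of automata, i.e. there is no $m\ge 1$, no collective $\mathcal A=(\mathfrak A_1,\dots,\mathfrak A_m)$ of $(G,S)$-admissible finite automata with initial states $\vec q_0$ and no tuple of initial vertices $\vec v_0\in G^m$ such that $\mathcal A_{\vec q_0}$ traverses $\Gamma_{\vec v_0}$; (ii) $G$ is infinite and has no element of infinite order.
   Context: The Cayley graph $\Gamma(G,S)$ has vertex set $G$; its edges join $v$ and $vs$ for $v\in G$, $s\in S\cup S^{-1}$, where $S^{-1}=\{s^{-1}: s\in S\}$; $e$ is the identity of $G$. A finite automaton is a tuple $\mathfrak A=(A,Q,B,\phi,\psi)$ with finite sets $A$ (inputs), $Q$ (states), $B$ (outputs) and functions $\phi:Q\times A\to Q$, $\psi:Q\times A\to B$. A collective of $(G,S)$-admissible automata is a tuple $\mathcal A=(\mathfrak A_1,\dots,\mathfrak A_m)$, $\mathfrak A_i=(A_i,Q_i,B_i,\phi_i,\psi_i)$, such that, for a fixed symbol $\theta\notin\bigcup_i Q_i$, $A_i=\{a\in\prod_{j=1}^m(\{\theta\}\cup Q_j): \text{the } i\text{-th coordinate of } a \text{ is } \theta\}$ and $B_i=S\cup S^{-1}\cup\{e\}$. With initial states $\vec q_0=(q_0^1,\dots,q_0^m)$, $q_0^i\in Q_i$, it is denoted $\mathcal A_{\vec q_0}$. For $\vec q=(q_1,\dots,q_m)$, $q_j\in Q_j$,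 and $\vec v=(v_1,\dots,v_m)\in G^m$, let $a_i(\vec q,\vec v)\in A_i$ be the tuple whose $j$-th coordinate is $q_j$ if $j\ne i$ and $v_j=v_i$, and $\theta$ otherwise (each automaton sees exactly the states of the other automata standing at its own vertex). The behaviour of $\mathcal A_{\vec q_0}$ in $\Gamma$ with initial vertices $\vec v_0=(v_0^1,\dots,v_0^m)\in G^m$ is the sequence $(\vec q_t,\vec v_t)_{t\ge0}$ defined by $q_{t+1}^i=\phi_i(q_t^i,a_i(\vec q_t,\vec v_t))$ and $v_{t+1}^i=v_t^i\,\psi_i(q_t^i,a_i(\vec q_t,\vec v_t))$. $\mathcal A_{\vec q_0}$ traverses $\Gamma_{\vec v_0}$ if every vertex of $\Gamma$ equals $v_t^i$ for some $t\ge0$ and some $1\le i\le m$. *)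

(* Defs.v *)
From mathcomp Require Import all_boot finmap.
From mathcomp Require Import classical_sets cardinality.

Set Implicit Arguments.
Unset Strict Implicit.
Unset Printing Implicit Defensive.

Local Open Scope group_scope.

Section GeneratingSets.
Variable G : groupType.

Definition is_subgroup (H : set G) : Prop :=
  H 1 /\ forall x y, H x -> H y -> H (x * y^-1).

Definition generates (S : {fset G}) : Prop :=
  smallest is_subgroup [set` S]%classic = [set: G]%classic.

Definition infinite_order (g : G) : Prop :=
  forall n : nat, (0 < n)%N -> g ^+ n <> 1.

Definition sym_set (S : {fset G}) : {fset G} :=
  (S `|` [fset s^-1 | s in S])%fset.

End GeneratingSets.

Record graph := Graph { vertex :> Type; edge : vertex -> vertex -> Prop }.

Definition cayley (G : groupType) (S : {fset G}) : graph :=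
  {| vertex := G;
     edge := fun u v => exists2 s, s \in sym_set S & v = u * s |}.

Record automaton (A Q B : finType) := Automaton {
  next_state : Q -> A -> Q;
  output : Q -> A -> B
}.

(* The symbol theta is None, so {theta} \cup Q_j is option (Q j). *)
Definition inputs (m : nat) (Q : 'I_m -> finType) (i : 'I_m) : finType :=
  {a : {dffun forall j : 'I_m, option (Q j)} | a i == None}.

Definition outputs (G : groupType) (S : {fset G}) : finType :=
  (sym_set S `|` [fset 1])%fset.

Record collective (G : groupType) (S : {fset G}) (m : nat) := Collective {
  states : 'I_m -> finType;
  member : forall i, automaton (inputs states i) (states i) (outputs S)
}.

Section Behaviour.
Variables (G : groupType) (S : {fset G}) (m : nat) (C : collective S m).

Definition seen_fun (q : forall i, states C i) (v : 'I_m -> G) (i : 'I_m) :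
    {dffun forall j : 'I_m, option (states C j)} :=
  [ffun j => if (j != i) && (v j == v i) then Some (q j) else None].

Lemma seen_fun_self q v i : seen_fun q v i i == None.
Proof. by rewrite ffunE eqxx. Qed.

Definition seen (q : forall i, states C i) (v : 'I_m -> G) (i : 'I_m) :
    inputs (states C) i :=
  exist _ (seen_fun q v i) (seen_fun_self q v i).

Definition config : Type := (forall i, states C i) * ('I_m -> G).

Definition step (c : config) : config :=
  let: (q, v) := c in
  (fun i => next_state (member C i) (q i) (seen q v i),
   fun i => v i * fsval (output (member C i) (q i) (seen q v i))).

Definition behaviour (q0 : forall i, states C i) (v0 : 'I_m -> G) (t : nat) :
    config :=
  iter t step (q0, v0).

Definition traverses (q0 : forall i, states C i) (v0 : 'I_m -> G) : Prop :=
  forall x : cayley S, exists (t : nat) (i : 'I_m), (behaviour q0 v0 t).2 i = x.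

End Behaviour.

(* Main.v *)
Require Import Defs.
From mathcomp Require Import all_boot finmap.
From mathcomp Require Import boolp classical_sets cardinality.

(** A collective whose automata do not drift apart is a finite system up to left
    translation, so it gets far away only by being translated again and again
    by one element, which must then have infinite order.  Conversely, an element
    of infinite order provides the unbounded memory that a collective needs.

    Suppose that every element has finite order ([traverses_finite]).  By
    induction on the number of automata there is one finite set F, independent
    of the configuration, such that every automaton always stays in the union
    of the v_j F, where the v_j are the initial vertices
    ([confined_uniformly]).  If the automata form two groups so far apart that
    the regions granted to them by the induction hypothesis are disjoint, the
    groups never meet and each of them behaves as if it were alone
    ([confined_apart]).  Otherwise all automata are close to one another, and
    up to a left translation there are only finitely many such configurations.
    A run in which this persists repeats a configuration up to translation by
    some x, hence returns to an earlier configuration because x has finite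
    order ([orbit_finite]).  So a traversed graph is finite.

    Conversely, |G| idle automata traverse a finite graph.  If g has infinite
    order, one leading automaton with four obedient ones used as pebbles
    suffices ([infinite_order_traverses]).  A pebble at v g^n stores the number
    n at the vertex v; walking along the ray v, vg, vg^2, ... the leader can
    compute remainders and quotients of n, and by walking back and forth
    between two rays it can move the stored number from v to a neighbour of v
    ([exec_transfer]).  The tour that the leader makes is read off from base K
    counting.  Fix a closed sequence of letters t_1, ..., t_{K-1} whose prefix
    products p_0 = 1, p_1, ..., p_{K-1} = 1 include every generator and its
    inverse.  If n has the base K digits d_k ... d_0, put
    v_n = p_{d_k} ... p_{d_0}.  These products exhaust G, and v_n differs from
    v_{n-1} by the single letter t_d, where d is the last nonzero digit of n:
    the carries do not contribute since p_{K-1} = p_0 ([tour_digit]).  Hence to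
    pass from v_{n-1} to v_n it is enough to compute this digit from the number
    n stored at v_{n-1}, and to store n + 1 at v_n. *)

Set Implicit Arguments.
Unset Strict Implicit.
Unset Printing Implicit Defensive.

(** * Collectives in torsion groups are confined *)

Section Confinement.
Local Open Scope group_scope.
Variables (G : groupType) (S : {fset G}) (m : nat) (C : collective S m).
Implicit Types (I J : {set 'I_m}) (c : config C) (F B : seq G).

Definition seen_in_fun I (q : forall i, states C i) (v : 'I_m -> G) (i : 'I_m) :
    {dffun forall j : 'I_m, option (states C j)} :=
  [ffun j => if (j != i) && ((j \in I) && (v j == v i)) then Some (q j)
             else None].

Lemma seen_in_fun_self I q v i : seen_in_fun I q v i i == None.
Proof. by rewrite ffunE eqxx. Qed.

Definition seen_in I q v i : inputs (states C) i :=
  exist _ (seen_in_fun I q v i) (seen_in_fun_self I q v i).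

(** The dynamics in which only the automata of [I] are visible; the automata of
    [I] then evolve as the collective formed by them alone. *)
Definition step_in I c : config C :=
  (fun i => next_state (member C i) (c.1 i) (seen_in I c.1 c.2 i),
   fun i => c.2 i * fsval (output (member C i) (c.1 i) (seen_in I c.1 c.2 i))).

Lemma step_inT c : step_in [set: 'I_m] c = step c.
Proof.
case: c => q v; rewrite /step_in /=.
have E i : seen_in [set: 'I_m] q v i = seen q v i.
  by apply: val_inj; apply/ffunP => j; rewrite !ffunE inE.
by congr pair; apply: functional_extensionality_dep => i; rewrite E.
Qed.

Definition shifted I (x : G) c c' :=
  forall i, i \in I -> c.1 i = c'.1 i /\ c'.2 i = x * c.2 i.

(** A step is equivariant under left translation and depends only on who meets
    whom: two dynamics send translated configurations of [J] to translated ones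
    as soon as, in both of them, members of [J] meet only members of [J] that
    the other dynamics sees too. *)
Lemma step_in_local I I' x c c' J :
  shifted J x c c' ->
  (forall i j, i \in J -> j != i -> (j \in I) && (c.2 j == c.2 i) ->
     (j \in J) && (j \in I')) ->
  (forall i j, i \in J -> j != i -> (j \in I') && (c'.2 j == c'.2 i) ->
     (j \in J) && (j \in I)) ->
  shifted J x (step_in I c) (step_in I' c').
Proof.
move=> sh H H' i iJ; have [eqi evi] := sh i iJ.
suff E : seen_in I c.1 c.2 i = seen_in I' c'.1 c'.2 i.
  by rewrite /= -E eqi; split=> //; rewrite evi mulgA.
apply: val_inj; apply/ffunP => j; rewrite !ffunE.
case: (altP (j =P i)) => //= ji.
have [h|h] := boolP ((j \in I) && (c.2 j == c.2 i)).
  have /andP[jJ jI'] := H _ _ iJ ji h; have [eqj evj] := sh j jJ.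
  case/andP: h => _ /eqP h.
  by rewrite jI' evj evi h eqxx eqj.
have [h'|//] := boolP ((j \in I') && (c'.2 j == c'.2 i)).
have /andP[jJ jI] := H' _ _ iJ ji h'; have [eqj evj] := sh j jJ.
case/andP: h' => _; rewrite evj evi => /eqP/mulgI h'.
by rewrite jI h' eqxx in h.
Qed.

Lemma shifted_iter I x c c' t : shifted I x c c' ->
  shifted I x (iter t (step_in I) c) (iter t (step_in I) c').
Proof.
move=> sh; elim: t => //= t IH.
by apply: step_in_local IH _ _ => i j iI ji /andP[-> _].
Qed.

Lemma shifted_trans I x y c c' c'' :
  shifted I x c c' -> shifted I y c' c'' -> shifted I (y * x) c c''.
Proof.
move=> sh sh' i iI; have [-> e] := sh i iI; have [-> e'] := sh' i iI.
by rewrite e' e mulgA.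
Qed.

Definition confined I c F :=
  forall t i, i \in I ->
    exists2 j, j \in I & (c.2 j)^-1 * (iter t (step_in I) c).2 i \in F.

Definition quotients F : seq G := [seq x * y^-1 | x <- F, y <- F].

(** The regions v_i F and v_j F are then disjoint: v_i x = v_j y with x, y in F
    means that v_i^-1 v_j = x y^-1. *)
Definition apart F I J c :=
  forall i j, i \in I -> j \in J -> (c.2 i)^-1 * c.2 j \notin quotients F.

Lemma apart_neq F I J c t i j : confined I c F -> confined J c F ->
  apart F I J c -> i \in I -> j \in J ->
  (iter t (step_in I) c).2 i <> (iter t (step_in J) c).2 j.
Proof.
move=> cI cJ ap iI jJ e.
have [i' i'I hi] := cI t i iI; have [j' j'J hj] := cJ t j jJ.
have /negP[] := ap _ _ i'I j'J; apply/allpairsP.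
exists ((c.2 i')^-1 * (iter t (step_in I) c).2 i,
        (c.2 j')^-1 * (iter t (step_in J) c).2 j); split=> //=.
by rewrite e invgM invgK mulgA mulgK.
Qed.

(** As long as both groups have evolved as if alone they stay in disjoint
    regions, so nobody meets the other group, and the next step is again the
    one of the isolated groups. *)
Lemma confined_apart F I J c : confined I c F -> confined J c F ->
  [disjoint I & J] -> apart F I J c -> confined (I :|: J) c F.
Proof.
move=> cI cJ dIJ ap.
have dis i : i \in I -> i \in J -> False.
  by move=> iI iJ; move/pred0P: dIJ => /(_ i) /=; rewrite iI iJ.
have {dis} agree t :
    shifted I 1 (iter t (step_in I) c) (iter t (step_in (I :|: J)) c) /\
    shifted J 1 (iter t (step_in J) c) (iter t (step_in (I :|: J)) c).
  elim: t => [|t [shI shJ]] /=; first by split=> i _; rewrite mul1g.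
  split; [apply: (step_in_local shI)|apply: (step_in_local shJ)];
    move=> i j ii ji; rewrite ?inE => /andP[jj e]; rewrite ?inE ?jj ?orbT //.
    case/orP: jj => jj; first by rewrite jj.
    have [_ ei] := shI i ii; have [_ ej] := shJ j jj.
    move: e; rewrite ei ej !mul1g => /eqP e.
    by case: (apart_neq (t := t) cI cJ ap ii jj).
  case/orP: jj => jj; last by rewrite jj.
  have [_ ei] := shJ i ii; have [_ ej] := shI j jj.
  move: e; rewrite ei ej !mul1g => /eqP e.
  by case: (apart_neq (t := t) cI cJ ap jj ii).
move=> t i; have [aI aJ] := agree t; rewrite inE => /orP[] ii.
  have [_] := aI i ii; rewrite mul1g => ->.
  by have [j jI h] := cI t i ii; exists j; rewrite // inE jI.
have [_] := aJ i ii; rewrite mul1g => ->.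
by have [j jI h] := cJ t i ii; exists j; rewrite // inE jI orbT.
Qed.

Definition splits F I c :=
  exists J : {set 'I_m}, [/\ J \proper I, (0 < #|J|)%N & apart F J (I :\: J) c].

Fixpoint ball B n : seq G :=
  if n is n'.+1 then [seq x * y | x <- 1 :: B, y <- ball B n'] else [:: 1].

Lemma mem_ballS B n x y :
  x \in 1 :: B -> y \in ball B n -> x * y \in ball B n.+1.
Proof. by move=> xB yB; apply/allpairsP; exists (x, y). Qed.

Lemma ball_path B (v : 'I_m -> G) (e : rel 'I_m) i p :
  (forall i j, e i j -> (v i)^-1 * v j \in B) -> path e i p ->
  (v i)^-1 * v (last i p) \in ball B (size p).
Proof.
move=> eB; elim: p i => [|j p IH] i /=; first by rewrite mulVg mem_seq1.
case/andP=> eij ep.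
rewrite -(mulgK (v j) (v i)^-1) -mulgA; apply: mem_ballS (IH _ ep).
by rewrite inE eB ?orbT.
Qed.

Lemma sub_ball B n n' : (n <= n')%N -> {subset ball B n <= ball B n'}.
Proof.
move=> /subnK <-; elim: (n' - n)%N => // k IH x /IH h.
by rewrite addSn -(mul1g x); apply: mem_ballS h; apply: mem_head.
Qed.

(** The members reachable from [i0] through jumps in [quotients F] form a
    group which is apart from the rest; if there is no split, it is all of [I],
    and a path without repetition takes fewer than [m] jumps. *)
Lemma near_of_not_splits F I c i0 : ~ splits F I c -> i0 \in I ->
  forall i, i \in I -> (c.2 i0)^-1 * c.2 i \in ball (quotients F) m.
Proof.
move=> nspl i0I.
pose e i j := (j \in I) && ((c.2 i)^-1 * c.2 j \in quotients F).
pose J := [set i in I | connect e i0 i].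
have JI : J = I.
  apply/eqP; apply: contrapT => /negP JI; apply: nspl; exists J; split.
  - rewrite finset.properEneq JI; apply/fintype.subsetP=> i.
    by rewrite inE => /andP[].
  - by apply/card_gt0P; exists i0; rewrite inE i0I connect0.
  move=> i j; rewrite !inE => /andP[iI ci] /andP[ncj jI].
  apply: contra ncj => h; rewrite jI /=.
  by apply: connect_trans ci (connect1 _); rewrite /e jI.
move=> i; rewrite -{1}JI inE => /andP[_ /connectP[p ep ->]].
case: (shortenP ep) => p' ep' u _.
have := @ball_path (quotients F) c.2 e i0 p' _ ep'.
move=> /(_ (fun i j h => proj2 (andP h))); apply: sub_ball.
by have := max_card (mem (i0 :: p')); rewrite (card_uniqP u) card_ord => /ltnW.
Qed.

(** The class of a configuration up to left translation, as an element of a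
    finite type: relative positions are recorded by their index in [B], which
    loses nothing as long as they belong to [B]. *)
Definition key B (i0 : 'I_m) c :
    {dffun forall i, states C i} * {ffun 'I_m -> 'I_(size B).+1} :=
  ([ffun i => c.1 i], [ffun i => inord (index ((c.2 i0)^-1 * c.2 i) B)]).

Lemma key_shifted B I i0 c c' :
  (forall i, i \in I -> (c.2 i0)^-1 * c.2 i \in B) ->
  (forall i, i \in I -> (c'.2 i0)^-1 * c'.2 i \in B) ->
  key B i0 c = key B i0 c' -> shifted I (c'.2 i0 * (c.2 i0)^-1) c c'.
Proof.
move=> h h' [e1 e2] i iI; split.
  by have /ffunP/(_ i) := e1; rewrite !ffunE.
have /ffunP/(_ i)/(congr1 val) := e2; rewrite !ffunE /=.
rewrite !inordK ?ltnS ?index_size // => e.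
have := congr1 (nth 1 B) e; rewrite !nth_index ?h ?h' // => {}e.
by rewrite -mulgA e mulVKg.
Qed.

Lemma pigeonhole (K : finType) (f : nat -> K) :
  exists a b, (a < b)%N /\ f a = f b.
Proof.
have : ~ injective (fun i : 'I_#|K|.+1 => f i).
  by move/leq_card; rewrite card_ord ltnn.
move=> ninj; apply: contrapT => no; apply: ninj => a b fab; apply: val_inj.
by case: (ltngtP a b) => // h; case: no; [exists a, b | exists b, a].
Qed.

Definition visited I c T : seq G :=
  [seq (iter t (step_in I) c).2 i | t <- iota 0 T, i <- enum 'I_m].

Lemma mem_visited I c T t i : (t < T)%N ->
  (iter t (step_in I) c).2 i \in visited I c T.
Proof.
by move=> tT; apply/allpairsP; exists (t, i); rewrite mem_iota mem_enum.
Qed.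

Lemma shifted_power I x c p k : shifted I x c (iter p (step_in I) c) ->
  shifted I (x ^+ k) c (iter (k * p) (step_in I) c).
Proof.
move=> sh; elim: k => [|k IH]; first by rewrite mul0n => i _; rewrite mul1g.
rewrite mulSn addnC iterD expgSr.
apply: shifted_trans (_ : shifted I x c (iter p (step_in I) c)) _ => //.
by rewrite -iterD addnC iterD; apply: shifted_iter.
Qed.

(** From time [a] on, [n] periods of length [b - a] translate the
    configuration by [x ^+ n = 1], so the run is eventually periodic. *)
Lemma visited_of_shifted I x c a b n : (a < b)%N -> (0 < n)%N -> x ^+ n = 1 ->
  shifted I x (iter a (step_in I) c) (iter b (step_in I) c) ->
  exists W : seq G, forall t i, i \in I -> (iter t (step_in I) c).2 i \in W.
Proof.
move=> ab n0 xn; rewrite -(subnK (ltnW ab)) iterD => /(shifted_power n).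
rewrite xn; set P := (n * _)%N => sh.
have P0 : (0 < P)%N by rewrite muln_gt0 n0 subn_gt0.
exists (visited I c (P + a)) => t i iI.
elim/ltn_ind: t => t IH; case: (ltnP t (P + a)) => tP; first exact: mem_visited.
move: tP IH => /subnK <-; move: (t - _)%N => s IH.
have [_] := shifted_iter s sh iI; rewrite mul1g -!iterD addnA -addnA => ->.
by apply: IH; rewrite ltn_add2l -{1}(add0n a) ltn_add2r.
Qed.

Hypothesis torsion : forall g : G, exists2 n, (0 < n)%N & g ^+ n = 1.

Lemma splits_confined F I c :
  (forall J c', J \proper I -> confined J c' F) -> splits F I c ->
  confined I c F.
Proof.
move=> FI [J [JI J0 ap]]; have [sJI _] := andP JI.
have -> : I = J :|: (I :\: J).
  by rewrite -{1}(finset.setID I J) (finset.setIidPr sJI).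
have DI : I :\: J \proper I.
  rewrite properEcard subsetDl cardsD (finset.setIidPr sJI) ltn_subrL J0.
  by apply: leq_trans J0 (subset_leq_card sJI).
apply: confined_apart ap; try exact: FI.
rewrite finset.disjoints_subset; apply/fintype.subsetP => x xJ.
by rewrite !finset.inE xJ.
Qed.

(** Either the configuration splits at some moment, and from then on the
    regions granted to smaller groups apply, or it never does; then some class
    of configurations up to translation occurs twice. *)
Lemma orbit_finite F I c i0 : i0 \in I ->
  (forall J c', J \proper I -> confined J c' F) ->
  exists W : seq G, forall t i, i \in I -> (iter t (step_in I) c).2 i \in W.
Proof.
move=> i0I FI; have [[t0 spl]|never] :=
  pselect (exists t, splits F I (iter t (step_in I) c)).
  exists (visited I c t0 ++
    [seq (iter t0 (step_in I) c).2 j * f | j <- enum 'I_m, f <- F]).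
  move=> t i iI; rewrite mem_cat; case: (ltnP t t0) => tt0.
    by rewrite mem_visited.
  apply/orP; right; rewrite -(subnK tt0) iterD.
  have /(_ (t - t0)%N i iI) [j jI h] := splits_confined FI spl.
  apply/allpairsP; eexists (j, _).
  by split; [exact: mem_enum|exact: h|rewrite /= mulVKg].
pose B := ball (quotients F) m.
have [a [b [ab eab]]] := pigeonhole (fun t => key B i0 (iter t (step_in I) c)).
have nspl t : ~ splits F I (iter t (step_in I) c).
  by move=> h; apply: never; exists t.
have near t := near_of_not_splits (@nspl t) i0I.
have sh := key_shifted (near a) (near b) eab.
have [n n0 xn] := torsion ((iter b (step_in I) c).2 i0
                           * ((iter a (step_in I) c).2 i0)^-1).
exact: visited_of_shifted ab n0 xn sh.
Qed.

Lemma uniform_choice (K : finType) (P : K -> seq G -> Prop) :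
  (forall k F F', {subset F <= F'} -> P k F -> P k F') ->
  (forall k, exists F, P k F) -> exists F, forall k, P k F.
Proof.
move=> mono ex.
suff [F HF] : exists F, forall k, k \in enum K -> P k F.
  by exists F => k; apply: HF; rewrite mem_enum.
elim: (enum K) => [|k s [F HF]]; first by exists [::].
have [F' HF'] := ex k; exists (F' ++ F) => k'; rewrite inE => /predU1P[->|k's].
  by apply: mono HF' => x xF; rewrite mem_cat xF.
by apply: mono (HF _ k's) => x xF; rewrite mem_cat xF orbT.
Qed.

Lemma sub_confined F F' I c :
  {subset F <= F'} -> confined I c F -> confined I c F'.
Proof. by move=> sF h t i iI; have [j jI /sF hj] := h t i iI; exists j. Qed.

(** The bound is uniform because the configurations that do not split form
    finitely many classes up to translation, and translating a configuration
    translates its whole run. *)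
Lemma confined_not_splits F I :
  (forall J c, J \proper I -> confined J c F) ->
  exists F', forall c, ~ splits F I c -> confined I c F'.
Proof.
move=> FI; have [I0|[i0 i0I]] := set_0Vmem I.
  by exists [::] => c _ t i; rewrite I0 inE.
pose B := ball (quotients F) m.
suff [F' HF'] : exists F', forall k c, ~ splits F I c -> key B i0 c = k ->
    forall t i, i \in I -> (c.2 i0)^-1 * (iter t (step_in I) c).2 i \in F'.
  exists F' => c nspl t i iI; exists i0 => //; exact: HF' erefl _ _ _.
apply: uniform_choice => [k F1 F2 sF h c nspl ek t i iI|k].
  by apply: sF; apply: h.
have [[c [nspl ek]]|no] := pselect (exists c, ~ splits F I c /\ key B i0 c = k);
  last by exists [::] => c nspl ek; case: no; exists c.
have [W HW] := orbit_finite c i0I FI.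
exists [seq (c.2 i0)^-1 * w | w <- W] => c' nspl' ek' t i iI.
have sh : shifted I (c'.2 i0 * (c.2 i0)^-1) c c'.
  apply: (@key_shifted B); last by rewrite ek ek'.
    exact: near_of_not_splits nspl i0I.
  exact: near_of_not_splits nspl' i0I.
have [_ ->] := shifted_iter t sh iI.
by rewrite -mulgA mulKg map_f // HW.
Qed.

Lemma confined_uniformly n :
  exists F, forall I c, (#|I| <= n)%N -> confined I c F.
Proof.
elim: n => [|n [F HF]].
  by exists [::] => I c; rewrite leqn0 cards_eq0 => /eqP -> t i; rewrite inE.
have [F' HF'] : exists F', forall I, (#|I| <= n.+1)%N ->
    forall c, ~ splits F I c -> confined I c F'.
  apply: uniform_choice => [I F1 F2 sF h In c nspl|I].
    exact: sub_confined sF (h In c nspl).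
  have [In|] := boolP (#|I| <= n.+1)%N; last by exists [::].
  have [|F' h] := @confined_not_splits F I; last by exists F'.
  move=> J c /proper_card JI; apply: HF.
  by rewrite -ltnS; apply: leq_trans JI In.
exists (F ++ F') => I c In.
have [spl|nspl] := pselect (splits F I c).
  apply: (@sub_confined F); first by move=> x xF; rewrite mem_cat xF.
  apply: splits_confined spl => J c' /proper_card JI; apply: HF.
  by rewrite -ltnS; apply: leq_trans JI In.
apply: (@sub_confined F'); first by move=> x xF; rewrite mem_cat xF orbT.
exact: HF'.
Qed.

Lemma traverses_finite (q0 : forall i, states C i) (v0 : 'I_m -> G) :
  traverses q0 v0 -> finite_set [set: G]%classic.
Proof.
move=> tr; have [F HF] := confined_uniformly m.
apply: sub_finite_set (finite_seq [seq v0 j * f | j <- enum 'I_m, f <- F]).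
move=> x _ /=; have [t [i <-]] := tr x.
have [|//|j _ h] := HF [set: 'I_m] (q0, v0) _ t i;
  rewrite ?cardsT ?card_ord ?inE //.
rewrite /behaviour -(eq_iter step_inT).
apply/allpairsP; eexists (j, _).
by split; [exact: mem_enum|exact: h|rewrite /= mulVKg].
Qed.

End Confinement.

(** * A leader with pebbles *)

Section PebbleMachines.
Local Open Scope group_scope.
Variables (G : groupType) (S : {fset G}) (k : nat).

(** A single walker with [k] pebbles that recognizes which pebbles lie at its
    own vertex.  Its move and the set of pebbles that it takes along depend on
    its control state only, so that a pebble, being an automaton that sees the
    leader but not what the leader sees, can find out what to do. *)
Record pebble_machine := PebbleMachine {
  control : finType;
  emit : control -> outputs S * pred 'I_k;
  advance : control -> pred 'I_k -> control
}.

Definition carry (T : pred 'I_k) (h x : G) (p : {ffun 'I_k -> G}) :=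
  [ffun i => if T i && (p i == h) then p i * x else p i].

Definition machine_step (M : pebble_machine)
    (s : control M * (G * {ffun 'I_k -> G})) :=
  let: (q, (h, p)) := s in
  (advance q (fun i => p i == h),
   (h * fsval (emit q).1, carry (emit q).2 h (fsval (emit q).1) p)).

Lemma one_output : (1 : G) \in (sym_set S `|` [fset 1])%fset.
Proof. by rewrite in_fsetU in_fset1 eqxx orbT. Qed.

Definition out1 : outputs S := [` one_output]%fset.

Section Simulation.
Variable M : pebble_machine.

Let Q (i : 'I_k.+1) : finType := control M.

Definition sight i (a : inputs Q i) : {dffun forall j, option (Q j)} := sval a.

Definition member_of (i : 'I_k.+1) : automaton (inputs Q i) (Q i) (outputs S) :=
  if unlift ord0 i is Some j then
    Automaton (fun q (_ : inputs Q i) => q)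
      (fun q (a : inputs Q i) => if sight a ord0 is Some q0 then
                      if (emit q0).2 j then (emit q0).1 else out1
                    else out1)
  else
    Automaton
      (fun q (a : inputs Q i) =>
         advance q (fun j => isSome (sight a (lift ord0 j))))
      (fun q (a : inputs Q i) => (emit q).1).

Definition collective_of : collective S k.+1 := Collective member_of.

(** Automaton [ord0] is the leader, automaton [lift ord0 j] is pebble [j]. *)
Lemma machine_simulation (q0 : control M) h (p : {ffun 'I_k -> G}) t :
  let c := behaviour (C := collective_of) (fun=> q0)
             (fun i => if unlift ord0 i is Some j then p j else h) t in
  let s := iter t (@machine_step M) (q0, (h, p)) in
  [/\ c.1 ord0 = s.1, c.2 ord0 = s.2.1 & forall j, c.2 (lift ord0 j) = s.2.2 j].
Proof.
rewrite /behaviour; elim: t => [|t [IH1 IH2 IH3]] /=.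
  by split=> [||j]; rewrite ?unlift_none ?liftK.
case: (iter t _ _) IH1 IH2 IH3 => [q v] /=.
case: (iter t _ _) => [q' [h' p']] /=.
move=> eq ev evj; rewrite /member_of; split.
- rewrite unlift_none /= eq; congr advance.
  apply: functional_extensionality_dep => j.
  by rewrite ffunE /= ev evj; case: (p' j == h').
- by rewrite unlift_none /= ev eq.
move=> j; rewrite liftK /= !ffunE /= ev evj eq (eq_sym h').
by case: (p' j == h'); case: ((emit _).2 j) => //=; rewrite mulg1.
Qed.

End Simulation.

Lemma machine_traverses (M : pebble_machine) q0 h (p : {ffun 'I_k -> G}) :
  (forall x, exists t, (iter t (@machine_step M) (q0, (h, p))).2.1 = x) ->
  exists (m : nat) (C : collective S m)
       (q0 : forall i : 'I_m, states C i) (v0 : 'I_m -> G),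
       (0 < m)%N /\ traverses q0 v0.
Proof.
move=> H; exists k.+1, (collective_of M), (fun=> q0),
  (fun i => if unlift ord0 i is Some j then p j else h); split=> // x.
have [t <-] := H x; exists t, ord0.
by have [_ -> _] := machine_simulation q0 h p t.
Qed.

(** Programs for pebble machines: a register with values in [R], tests of the
    register and of the pebbles in view, and unbounded loops.  [loc c] is the
    finite set of locations of the program counter in [c]; each location takes
    one unit of time, and [None] as the next location means termination.  In a
    loop the location [None] is the evaluation of the test. *)
Variable R : finType.

Inductive cmd :=
  | Go of (R -> outputs S) & pred 'I_k
  | Upd of (R -> R)
  | Seq of cmd & cmd
  | While of (R -> pred 'I_k -> bool) & cmd.

Fixpoint loc (c : cmd) : finType :=
  match c with
  | Go _ _ | Upd _ => unit
  | Seq a b => (loc a + loc b)%type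
  | While _ a => option (loc a)
  end.

Fixpoint start (c : cmd) : loc c :=
  match c with
  | Go _ _ | Upd _ => tt
  | Seq a b => inl (start a)
  | While _ a => None
  end.

Fixpoint cmd_emit (c : cmd) : loc c -> R -> outputs S * pred 'I_k :=
  match c with
  | Go y T => fun _ r => (y r, T)
  | Upd _ => fun _ _ => (out1, xpred0)
  | Seq a b => fun l r =>
      match l with inl l => cmd_emit l r | inr l => cmd_emit l r end
  | While _ a => fun l r =>
      if l is Some l then cmd_emit l r else (out1, xpred0)
  end.

Fixpoint cmd_next (c : cmd) : loc c -> R -> pred 'I_k -> option (loc c) * R :=
  match c with
  | Go _ _ => fun _ r _ => (None, r)
  | Upd f => fun _ r _ => (None, f r)
  | Seq a b => fun l r w =>
      match l with
      | inl l => let: (o, r) := cmd_next l r w in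
                 (Some (if o is Some l then inl l else inr (start b)), r)
      | inr l => let: (o, r) := cmd_next l r w in (omap inr o, r)
      end
  | While t a => fun l r w =>
      if l is Some l then let: (o, r) := cmd_next l r w in (Some o, r)
      else (if t r w then Some (Some (start a)) else None, r)
  end.

Definition world : Type := R * (G * {ffun 'I_k -> G}).

Definition cmd_world c (l : loc c) (s : world) : world :=
  let: (r, (h, p)) := s in
  ((cmd_next l r (fun i => p i == h)).2,
   (h * fsval (cmd_emit l r).1,
    carry (cmd_emit l r).2 h (fsval (cmd_emit l r).1) p)).

Definition cmd_loc c (l : loc c) (s : world) : option (loc c) :=
  (cmd_next l s.1 (fun i => s.2.2 i == s.2.1)).1.

(** Terminating computations.  A loop can fail to terminate, so this is a
    relation and not a function of the initial world. *)
Inductive run c : loc c -> world -> world -> Prop :=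
  | run_exit l s : cmd_loc l s = None -> run l s (cmd_world l s)
  | run_step l l' s s' : cmd_loc l s = Some l' -> run l' (cmd_world l s) s' ->
      run l s s'.

Definition exec c := run (start c).

Implicit Types (p : {ffun 'I_k -> G}) (h : G).

Lemma carry0 h x p : carry xpred0 h x p = p.
Proof. by apply/ffunP => i; rewrite ffunE. Qed.

Lemma exec_Upd f r w : exec (Upd f) (r, w) (f r, w).
Proof.
case: w => h p; have -> : (f r, (h, p)) = cmd_world (c := Upd f) tt (r, (h, p)).
  by rewrite /= mulg1 carry0.
exact: run_exit.
Qed.

Lemma exec_Go y T r h p :
  exec (Go y T) (r, (h, p)) (r, (h * fsval (y r), carry T h (fsval (y r)) p)).
Proof. exact: (@run_exit (Go y T) tt (r, (h, p))). Qed.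

Lemma seq_inl a b (l : loc a) s :
  (cmd_loc (c := Seq a b) (inl l) s
     = Some (if cmd_loc l s is Some l' then inl l' else inr (start b)))
  * (cmd_world (c := Seq a b) (inl l) s = cmd_world l s).
Proof. by case: s => r [h p]; rewrite /cmd_loc /=; case: (cmd_next _ _ _). Qed.

Lemma seq_inr a b (l : loc b) s :
  (cmd_loc (c := Seq a b) (inr l) s = omap inr (cmd_loc l s))
  * (cmd_world (c := Seq a b) (inr l) s = cmd_world l s).
Proof. by case: s => r [h p]; rewrite /cmd_loc /=; case: (cmd_next _ _ _). Qed.

Lemma while_some t a (l : loc a) s :
  (cmd_loc (c := While t a) (Some l) s = Some (cmd_loc l s))
  * (cmd_world (c := While t a) (Some l) s = cmd_world l s).
Proof. by case: s => r [h p]; rewrite /cmd_loc /=; case: (cmd_next _ _ _). Qed.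

Lemma exec_Seq a b s s' s'' :
  exec a s s' -> exec b s' s'' -> exec (Seq a b) s s''.
Proof.
have right_run m s1 s2 : run m s1 s2 -> run (c := Seq a b) (inr m) s1 s2.
  elim=> {m s1 s2} [m s1 em|m m' s1 s2 em _ IH].
    by rewrite -(seq_inr a m); apply: run_exit; rewrite seq_inr em.
  by apply: (@run_step (Seq a b) _ (inr m')); rewrite seq_inr ?em.
rewrite /exec /= => ra rb; elim: ra rb => {s s'} [l s el|l l' s s' el _ IH] rb.
  apply: (@run_step (Seq a b) _ (inr (start b))); rewrite seq_inl ?el //.
  exact: right_run.
by apply: (@run_step (Seq a b) _ (inl l')); rewrite seq_inl ?el //; apply: IH.
Qed.

Lemma exec_While_false (t : R -> pred 'I_k -> bool) a r h p :
  ~~ t r (fun i => p i == h) -> exec (While t a) (r, (h, p)) (r, (h, p)).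
Proof.
move=> tF; have E : cmd_world (c := While t a) None (r, (h, p)) = (r, (h, p)).
  by rewrite /= mulg1 carry0.
rewrite -{2}E; apply: run_exit; by rewrite /cmd_loc /= (negbTE tF).
Qed.

Lemma exec_While_true (t : R -> pred 'I_k -> bool) a r h p s' s'' :
  t r (fun i => p i == h) -> exec a (r, (h, p)) s' -> exec (While t a) s' s'' ->
  exec (While t a) (r, (h, p)) s''.
Proof.
move=> tT ra rw.
have E : cmd_world (c := While t a) None (r, (h, p)) = (r, (h, p)).
  by rewrite /= mulg1 carry0.
apply: (@run_step (While t a) _ (Some (start a))).
  by rewrite /cmd_loc /= tT.
rewrite {}E; move: ra; rewrite /exec; move: (start a) (r, (h, p)) => l s ra.
elim: ra rw => {l s s'} [l s el|l l' s s' el _ IH] rw.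
  by apply: (@run_step (While t a) _ None); rewrite while_some ?el.
apply: (@run_step (While t a) _ (Some l')); rewrite while_some ?el //.
exact: IH.
Qed.

Definition forever (c : cmd) : pebble_machine :=
  @PebbleMachine (loc c * R)%type
    (fun q => cmd_emit q.1 q.2)
    (fun q w => let: (o, r) := cmd_next q.1 q.2 w in (odflt (start c) o, r)).

Lemma forever_exec c r w r' w' : exec c (r, w) (r', w') ->
  exists n, iter n (@machine_step (forever c)) ((start c, r), w)
            = ((start c, r'), w').
Proof.
rewrite /exec; move: {1 2}(start c) => l.
move E : (r, w) => s; move E' : (r', w') => s' ru.
elim: ru r w r' w' E E' =>
  {s s' l} [l s el|l l' s s' el _ IH] r [h p] r' w' E E'.
  exists 1%N; move: el E'; rewrite -E /cmd_loc /=.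
  by case: (cmd_next _ _ _) => o r1 /= -> [-> ->].
have [n Hn] : exists n, iter n (@machine_step (forever c))
   ((l', (cmd_world l s).1), (cmd_world l s).2) = (start c, r', w').
  by apply: IH => //; case: (cmd_world l s).
exists n.+1; rewrite iterSr -Hn; congr iter; move: el; rewrite -E /cmd_loc /=.
by case: (cmd_next _ _ _) => o r1 /= ->.
Qed.

End PebbleMachines.

(** * Walking along a ray *)

Section Programs.
Local Open Scope group_scope.
Variables (G : groupType) (S : {fset G}) (R : finType).
Notation cmd := (cmd S 4 R).
Implicit Types (p : {ffun 'I_4 -> G}) (w : seq (outputs S)) (T : pred 'I_4).

Definition wprod w : G := foldr (fun y x => fsval y * x) 1 w.

Lemma wprod_cat w w' : wprod (w ++ w') = wprod w * wprod w'.
Proof. by elim: w => [|y w /= ->]; rewrite ?mul1g ?mulgA. Qed.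

Lemma wprod_power w n : wprod (flatten (nseq n w)) = wprod w ^+ n.
Proof. by elim: n => //= n IH; rewrite wprod_cat IH expgS. Qed.

Definition put T (x : G) p := [ffun i => if T i then x else p i].

Definition together T (h : G) p := forall i, T i -> p i = h.

Lemma carry_together T h x p :
  together T h p -> carry T h x p = put T (h * x) p.
Proof.
move=> Th; apply/ffunP => i; rewrite !ffunE; case Ti: (T i) => //=.
by rewrite Th // eqxx.
Qed.

Lemma together_put T x p : together T x (put T x p).
Proof. by move=> i Ti; rewrite ffunE Ti. Qed.

Lemma put_together T h p : together T h p -> put T h p = p.
Proof. by move=> Th; apply/ffunP => i; rewrite ffunE; case: ifP => // /Th. Qed.

Lemma put_put T x y p : put T y (put T x p) = put T y p.
Proof. by apply/ffunP => i; rewrite !ffunE; case: (T i). Qed.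

(** The pebbles of [T] are taken along; they are meant to lie with the walker
    at the start, and then none is picked up at an intermediate vertex. *)
Definition walk w T : cmd :=
  foldr (fun y c => Seq (Go (fun=> y) T) c) (Upd S 4 id) w.

Lemma exec_walk w T r h p x p' : together T h p ->
  wprod w = x -> put T (h * x) p = p' ->
  exec (walk w T) (r, (h, p)) (r, (h * x, p')).
Proof.
move=> Th <- <-; elim: w h p Th => [|y w IH] h p Th /=.
  by rewrite mulg1 put_together //; apply: exec_Upd.
apply: exec_Seq; first exact: exec_Go.
rewrite carry_together // mulgA -(put_put T (h * fsval y) (_ * wprod w)).
by apply: IH; apply: together_put.
Qed.

Definition until P w T : cmd := While (fun _ here => ~~ here P) (walk w T).

Lemma infinite_order_inj (x : G) n : infinite_order x -> x ^+ n = 1 -> n = 0%N.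
Proof. by case: n => // n /(_ n.+1 isT). Qed.

(** The pebble [P] lies [n] steps ahead; the walker does not stop earlier since
    the vertices on its way are distinct, [x] having infinite order. *)
Lemma exec_until P w T r h p x n h' p' : infinite_order x -> wprod w = x ->
  together T h p -> ~~ T P -> p P = h' -> h * x ^+ n = h' -> put T h' p = p' ->
  exec (until P w T) (r, (h, p)) (r, (h', p')).
Proof.
move=> xoo wx Th TP PP; elim: n h p p' Th PP => [|n IH] h p p' Th PP hh' <-.
  move: hh'; rewrite mulg1 => hh'; rewrite -hh' put_together //.
  by apply: exec_While_false; rewrite negbK PP hh'.
apply: exec_While_true; first 1 last.
- exact: exec_walk Th wx erefl.
- apply: IH; first exact: together_put.
  + by rewrite ffunE (negbTE TP).
  + by rewrite -mulgA -expgS.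
  + by rewrite put_put.
rewrite PP -hh' -{2}(mulg1 h); apply/eqP => /mulgI.
by move/(infinite_order_inj xoo).
Qed.

End Programs.

(** The pebble [pM] marks the current base vertex v and [pC] stores a number n
    by lying at v g^n.  The pebble [pD] stores an auxiliary number; [pE] is a
    second auxiliary, or marks the next base vertex. *)
Definition pM : 'I_4 := @Ordinal 4 0 isT.
Definition pC : 'I_4 := @Ordinal 4 1 isT.
Definition pD : 'I_4 := @Ordinal 4 2 isT.
Definition pE : 'I_4 := @Ordinal 4 3 isT.

Definition among (s : seq 'I_4) : pred 'I_4 := fun i => i \in s.

Definition at4 (G : groupType) (m c d e : G) : {ffun 'I_4 -> G} :=
  [ffun i : 'I_4 => nth m [:: m; c; d; e] i].

Lemma put_at4 (G : groupType) s (x m c d e : G) :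
  put (among s) x (at4 m c d e) =
  at4 (if pM \in s then x else m) (if pC \in s then x else c)
      (if pD \in s then x else d) (if pE \in s then x else e).
Proof.
apply/ffunP; case=> [[|[|[|[|//]]]]] i; rewrite !ffunE /= /among;
by congr (if _ \in s then _ else _); apply: val_inj.
Qed.

Lemma together_at4 (G : groupType) s (x m c d e : G) :
  (if pM \in s then m = x else True) -> (if pC \in s then c = x else True) ->
  (if pD \in s then d = x else True) -> (if pE \in s then e = x else True) ->
  together (among s) x (at4 m c d e).
Proof.
have H i P y : among s i -> i = P -> (if P \in s then y = x else True) -> y = x.
  by rewrite /among => si <-; rewrite si.
move=> HM HC HD HE; case=> [[|[|[|[|//]]]]] i si; rewrite ffunE /=.
- by apply: H si _ HM; apply: val_inj.
- by apply: H si _ HC; apply: val_inj.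
- by apply: H si _ HD; apply: val_inj.
- by apply: H si _ HE; apply: val_inj.
Qed.

Lemma put_nil (G : groupType) (x : G) p : put (among [::]) x p = p.
Proof. by apply/ffunP => i; rewrite ffunE. Qed.

(* Runs the first command of a sequence; the argument is its specification. *)
Ltac leg lem :=
  apply: exec_Seq;
  first (apply: lem;
         solve [eassumption | exact: put_nil | exact: put_at4 | by []
               | by apply: together_at4 | by rewrite ffunE]);
  rewrite /=.

(** * The last nonzero digit *)

Section LowDigit.
Variable K : nat.
Hypothesis K_gt1 : (1 < K)%N.

Definition strip x := if K %| x then x %/ K else x.

(** The last nonzero digit of [x > 0] in base [K].  A number ends with fewer
    than [x] zeros, and once they are gone [strip] does nothing. *)
Definition low_digit x := iter x strip x %% K.

Lemma low_digit_ndvd x : ~~ (K %| x) -> low_digit x = x %% K.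
Proof.
move=> Kx; rewrite /low_digit.
suff -> : iter x strip x = x by [].
by elim: {1}x => //= n ->; rewrite /strip (negbTE Kx).
Qed.

Lemma low_digit_mul x : (0 < x)%N -> low_digit (K * x) = low_digit x.
Proof.
move=> x0; have K0 : (0 < K)%N by apply: ltnW.
have fuel n y : (0 < y)%N -> (y <= n)%N -> ~~ (K %| iter n strip y).
  elim: n y => [|n IH] y y0; first by rewrite leqNgt y0.
  rewrite iterSr {2}/strip => yn; case: ifP => Ky.
    apply: IH; first by rewrite divn_gt0 // dvdn_leq.
    by rewrite -ltnS; apply: leq_trans yn; rewrite ltn_Pdiv.
  by elim: n {IH yn} => /= [|n IH]; rewrite ?Ky // {1}/strip (negbTE IH).
have stable n : iter (x + n) strip x = iter x strip x.
  elim: n => [|n IH]; first by rewrite addn0.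
  by rewrite addnS /= IH /strip (negbTE (fuel _ _ x0 _)).
have -> : low_digit (K * x) = iter (K * x).-1.+1 strip (K * x) %% K.
  by rewrite prednK // muln_gt0 K0.
rewrite iterSr {2}/strip dvdn_mulr // mulKn // /low_digit.
rewrite -(stable ((K * x).-1 - x)%N) subnKC //.
by rewrite -ltnS prednK ?muln_gt0 ?K0 // ltn_Pmull.
Qed.

End LowDigit.

(** * The program of the leader *)

Section Traversal.
Local Open Scope group_scope.
Variables (G : groupType) (S : {fset G}).
Variables (g : G) (gw gi : seq (outputs S)).
Hypothesis inf_g : infinite_order g.
Hypothesis gwE : wprod gw = g.
Hypothesis giE : wprod gi = g^-1.

Lemma inf_gV : infinite_order g^-1.
Proof.
by move=> n n0; rewrite expVgn => /(canRL invgK); rewrite invg1; apply: inf_g.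
Qed.

Variable ts : seq (outputs S).
Hypothesis ts0 : (0 < size ts)%N.
Let K := (size ts).+1.
Let R : finType := 'I_K.
Notation cmd := (cmd S 4 R).
Implicit Types (r : R) (v : G) (p : {ffun 'I_4 -> G}).

Infix ";;" := (@Seq G S 4 R) (at level 60, right associativity).

Definition up P T : cmd := until R P gw (among T).
Definition down P T : cmd := until R P gi (among T).
Definition walkc w T : cmd := walk R w (among T).
Definition away P (_ : R) (here : pred 'I_4) := ~~ here P.

Lemma exec_up P T r v p n p' :
  together (among T) v p -> P \notin T -> p P = v * g ^+ n ->
  put (among T) (v * g ^+ n) p = p' ->
  exec (up P T) (r, (v, p)) (r, (v * g ^+ n, p')).
Proof. by move=> tv PT Pp; apply: (exec_until r inf_g gwE tv PT Pp). Qed.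

Lemma exec_down P T r v p n p' :
  together (among T) (v * g ^+ n) p -> P \notin T -> p P = v ->
  put (among T) v p = p' ->
  exec (down P T) (r, (v * g ^+ n, p)) (r, (v, p')).
Proof.
move=> tv PT Pp; apply: (exec_until r inf_gV giE tv PT Pp (n := n)).
by rewrite expVgn mulgK.
Qed.

Definition giK := flatten (nseq K gi).

Lemma giKE : wprod giK = g^-1 ^+ K.
Proof. by rewrite wprod_power giE. Qed.

(** Each round takes [K] from the number of [pD] and adds 1 to that of [pE]. *)
Definition divide_round : cmd :=
  up pD [::] ;; walkc giK [:: pD] ;; down pM [::] ;;
  up pE [::] ;; walkc gw [:: pE] ;; down pM [::].

Definition divide : cmd :=
  While (away pD) divide_round ;; up pE [:: pD] ;; down pM [:: pE].

Lemma exec_divide_round r v c x e :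
  exec divide_round
    (r, (v, at4 v c (v * g ^+ (K + x)) (v * g ^+ e)))
    (r, (v, at4 v c (v * g ^+ x) (v * g ^+ e.+1))).
Proof.
have step : v * g ^+ (K + x) * g^-1 ^+ K = v * g ^+ x.
  by rewrite addnC expgnDr expVgn mulgA mulgK.
have step' : v * g ^+ e * g = v * g ^+ e.+1 by rewrite expgSr mulgA.
leg exec_up.
have giK' := giKE; leg exec_walk.
rewrite step.
leg exec_down.
leg exec_up.
leg exec_walk.
rewrite step'.
by apply: exec_down; rewrite ?put_at4 ?ffunE //; apply: together_at4.
Qed.

Lemma exec_divide r v c y :
  exec divide
    (r, (v, at4 v c (v * g ^+ (K * y)) v)) (r, (v, at4 v c (v * g ^+ y) v)).
Proof.
have loop e z : exec (While (away pD) divide_round)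
    (r, (v, at4 v c (v * g ^+ (K * z)) (v * g ^+ e)))
    (r, (v, at4 v c v (v * g ^+ (e + z)))).
  elim: z e => [|z IH] e.
    rewrite muln0 addn0 mulg1; apply: exec_While_false.
    by rewrite /away ffunE eqxx.
  rewrite mulnS; apply: exec_While_true (exec_divide_round r v c _ e) _.
    rewrite /away ffunE /= -{2}(mulg1 v); apply/eqP => /mulgI.
    by move/(infinite_order_inj inf_g).
  by have := IH e.+1; rewrite addSnnS.
have := loop 0%N y; rewrite expg0 mulg1 add0n => {}loop.
apply: exec_Seq loop _.
leg exec_up.
by apply: exec_down; rewrite ?put_at4 ?ffunE //; apply: together_at4.
Qed.

(** The distance from the base to [pD] modulo [K] is counted in the register. *)
Definition peek : cmd :=
  Upd S 4 (fun=> ord0) ;;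
  While (away pD) (walkc gw [::] ;; Upd S 4 (@ordS _)) ;;
  down pM [::].

Lemma exec_peek r v c x e :
  exec peek (r, (v, at4 v c (v * g ^+ x) e))
            (iter x (@ordS _) ord0, (v, at4 v c (v * g ^+ x) e)).
Proof.
apply: exec_Seq; first exact: exec_Upd.
have loop h s p : p pD = h * g ^+ x ->
    exec (While (away pD) (walkc gw [::] ;; Upd S 4 (@ordS _)))
      (s, (h, p)) (iter x (@ordS _) s, (h * g ^+ x, p)).
  elim: x h s => [|x IH] h s pD_; rewrite ?mulg1 in pD_ *.
    by apply: exec_While_false; rewrite /away pD_ eqxx.
  have one : exec (walkc gw [::] ;; Upd S 4 (@ordS _))
      (s, (h, p)) (ordS s, (h * g, p)).
    by leg exec_walk; apply: exec_Upd.
  apply: exec_While_true one _; last first.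
    by rewrite iterSr expgS mulgA; apply: IH; rewrite -mulgA -expgS.
  rewrite /away pD_ -{2}(mulg1 h); apply/eqP => /mulgI.
  by move/(infinite_order_inj inf_g).
apply: exec_Seq; first by apply: loop; rewrite ffunE.
by apply: exec_down; rewrite ?put_nil ?ffunE //; move=> i.
Qed.

Lemma val_iter_ordS x : val (iter x (@ordS K) ord0) = x %% K.
Proof. by elim: x => [|x IH] /=; rewrite ?mod0n // IH -addn1 modnDml addn1. Qed.

Definition reduce : cmd := While (fun r _ => r == ord0) (divide ;; peek).

Lemma exec_reduce v c x : (0 < x)%N -> exists x' r, val r = low_digit K x /\
  exec reduce (iter x (@ordS _) ord0, (v, at4 v c (v * g ^+ x) v))
              (r, (v, at4 v c (v * g ^+ x') v)).
Proof.
elim/ltn_ind: x => x IH x0; have [Kx|Kx] := boolP (K %| x); last first.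
  exists x, (iter x (@ordS _) ord0).
  rewrite low_digit_ndvd // val_iter_ordS; split=> //.
  by apply: exec_While_false; rewrite -val_eqE val_iter_ordS.
case/dvdnP: Kx => y xE; have y0 : (0 < y)%N by case: y xE x0 => // ->.
have [|x' [s [sE ex]]] := IH y _ y0; first by rewrite xE ltn_Pmulr.
exists x', s; rewrite xE mulnC low_digit_mul //; split=> //.
apply: exec_While_true ex; first by rewrite -val_eqE val_iter_ordS modnMr.
exact: exec_Seq (exec_divide _ _ _ _) (exec_peek _ _ _ _ _).
Qed.

Lemma inv_output (y : outputs S) :
  (fsval y)^-1 \in (sym_set S `|` [fset 1])%fset.
Proof.
have := fsvalP y; rewrite !in_fsetU !in_fset1 invg_eq1.
case/orP=> [|->]; last by rewrite orbT.
case/orP=> [yS|/imfsetP[z /= zS ->]]; last by rewrite invgK zS.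
by rewrite in_imfset ?orbT.
Qed.

Definition inv_out (y : outputs S) : outputs S := [` inv_output y]%fset.

Definition letter (d : nat) : outputs S := nth (out1 S) ts d.-1.

Definition go T : cmd := Go (fun r : R => letter r) (among T).
Definition go_back : cmd := Go (fun r : R => inv_out (letter r)) (among [::]).

Lemma exec_go T r v p p' : together (among T) v p ->
  put (among T) (v * fsval (letter r)) p = p' ->
  exec (go T) (r, (v, p)) (r, (v * fsval (letter r), p')).
Proof. by move=> Tv <-; rewrite -carry_together //; apply: exec_Go. Qed.

Lemma exec_go_back r v p :
  exec go_back (r, (v * fsval (letter r), p)) (r, (v, p)).
Proof.
have := exec_Go (fun r => inv_out (letter r)) (among [::]) r
  (v * fsval (letter r)) p.
by rewrite carry_together ?put_nil ?mulgK //; move=> i.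
Qed.

(** Each round takes 1 from the number of [pC], at the old base, and adds 1 to
    that of [pD], at the new base marked by [pE]; the register tells how the
    two bases differ. *)
Definition transfer_round : cmd :=
  up pC [::] ;; walkc gi [:: pC] ;; down pM [::] ;; go [::] ;;
  up pD [::] ;; walkc gw [:: pD] ;; down pE [::] ;; go_back.

Lemma exec_transfer_round r v c d : let u := v * fsval (letter r) in
  exec transfer_round
    (r, (v, at4 v (v * g ^+ c.+1) (u * g ^+ d) u))
    (r, (v, at4 v (v * g ^+ c) (u * g ^+ d.+1) u)).
Proof.
move=> u; have stepC : v * g ^+ c.+1 * g^-1 = v * g ^+ c.
  by rewrite expgSr mulgA mulgK.
have stepD : u * g ^+ d * g = u * g ^+ d.+1 by rewrite expgSr mulgA.
leg exec_up.
leg exec_walk.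
rewrite stepC /=.
leg exec_down.
leg exec_go.
leg exec_up.
leg exec_walk.
rewrite stepD /=.
leg exec_down.
exact: exec_go_back.
Qed.

Definition transfer : cmd :=
  go [:: pD; pE] ;; go_back ;; While (away pC) transfer_round ;; go [:: pM; pC].

Lemma exec_transfer r v c : let u := v * fsval (letter r) in
  exec transfer (r, (v, at4 v (v * g ^+ c) v v))
                (r, (u, at4 u u (u * g ^+ c) u)).
Proof.
move=> u.
leg exec_go.
rewrite /=; apply: exec_Seq; first exact: exec_go_back.
have loop d z : exec (While (away pC) transfer_round)
    (r, (v, at4 v (v * g ^+ z) (u * g ^+ d) u))
    (r, (v, at4 v v (u * g ^+ (d + z)) u)).
  elim: z d => [|z IH] d.
    by rewrite addn0 mulg1; apply: exec_While_false; rewrite /away ffunE eqxx.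
  apply: exec_While_true (exec_transfer_round r v z d) _.
    rewrite /away ffunE /= -{2}(mulg1 v); apply/eqP => /mulgI.
    by move/(infinite_order_inj inf_g).
  by rewrite addnS -addSn; apply: IH.
have := loop 0%N c; rewrite mulg1 => {}loop; apply: exec_Seq loop _.
apply: exec_go; [by apply: together_at4|exact: put_at4].
Qed.

(** Found at the number n of [pD], the pebble [pC] is put one step further. *)
Definition increment : cmd :=
  up pD [:: pC] ;; walkc gw [:: pC] ;; walkc gi [::] ;; down pM [:: pD].

Lemma exec_increment r v c :
  exec increment (r, (v, at4 v v (v * g ^+ c) v))
                 (r, (v, at4 v (v * g ^+ c.+1) v v)).
Proof.
have step : v * g ^+ c * g = v * g ^+ c.+1 by rewrite expgSr mulgA.
leg exec_up.
leg exec_walk.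
leg exec_walk.
rewrite mulgK step /=.
by apply: exec_down; rewrite ?put_at4 ?ffunE //; apply: together_at4.
Qed.

(** The number of [pC] is copied by carrying [pD] to [pC]; the copy is divided
    by [K] until a nonzero remainder is left in the register; then [pD] is
    brought home and the number of [pC] goes to the next base. *)
Definition body : cmd :=
  (up pC [:: pD] ;; down pM [::]) ;; peek ;; reduce ;;
  (up pD [::] ;; down pM [:: pD]) ;; transfer ;; increment.

Lemma exec_body r v n : (0 < n)%N ->
  let u := v * fsval (letter (low_digit K n)) in
  exists r', exec body (r, (v, at4 v (v * g ^+ n) v v))
                       (r', (u, at4 u (u * g ^+ n.+1) u u)).
Proof.
move=> n0 u; have [x [s [sE red]]] := exec_reduce v (v * g ^+ n) n0.
exists s; rewrite {}/u -sE.
apply: exec_Seq.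
  leg exec_up.
  by rewrite /=; apply: exec_down; rewrite ?put_nil ?ffunE //; move=> i.
apply: exec_Seq; first exact: exec_peek.
apply: exec_Seq red _; apply: exec_Seq.
  leg exec_up.
  by apply: exec_down; rewrite ?put_at4 ?ffunE //; apply: together_at4.
exact: exec_Seq (exec_transfer _ _ _) (exec_increment _ _ _).
Qed.

Fixpoint tour (n : nat) : G :=
  if n is n'.+1 then tour n' * fsval (letter (low_digit K n)) else 1.

Lemma tour_visited n :
  exists t, (iter t (@machine_step _ _ _ (forever body))
               ((start body, ord0), (1, at4 1 g 1 1))).2.1 = tour n.
Proof.
suff [t [r E]] : exists t r, iter t (@machine_step _ _ _ (forever body))
    ((start body, ord0), (1, at4 1 g 1 1)) =
    ((start body, r),
     (tour n, at4 (tour n) (tour n * g ^+ n.+1) (tour n) (tour n))).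
  by exists t; rewrite E.
elim: n => [|n [t [r IH]]]; first by exists 0%N, ord0; rewrite mul1g.
have [r' /forever_exec[t' E]] := exec_body r (tour n) (ltn0Sn n).
by exists (t' + t)%N, r'; rewrite iterD IH E.
Qed.

Hypothesis ts_cycle : wprod ts = 1.

(** Among K n + 1, ..., K n + (K - 1) the last nonzero digit runs through
    1, ..., K - 1, so the tour follows the closed sequence [ts]; and K (n + 1)
    has the same last nonzero digit as n + 1. *)
Lemma tour_digit n d : (d <= size ts)%N ->
  tour (K * n + d) = tour n * wprod (take d ts).
Proof.
have digits n' d' : tour (K * n') = tour n' -> (d' <= size ts)%N ->
    tour (K * n' + d') = tour n' * wprod (take d' ts).
  move=> tn'; elim: d' => [|d' IH] d's; first by rewrite addn0 take0 mulg1.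
  rewrite addnS [tour _.+1]/= IH 1?ltnW // -addnS -mulgA; congr (_ * _).
  have -> : low_digit K (K * n' + d'.+1) = d'.+1.
    rewrite low_digit_ndvd mulnC ?modnMDl ?modn_small //.
    by rewrite /dvdn modnMDl modn_small.
  by rewrite (take_nth (out1 S)) // -cats1 wprod_cat /= mulg1.
suff tK : tour (K * n) = tour n by apply: digits.
elim: n => [|n IH]; first by rewrite muln0.
have -> : (K * n.+1)%N = (K * n + size ts).+1 by rewrite mulnS addnC -addnS.
rewrite [tour _.+1]/= digits // take_size ts_cycle mulg1 /=.
by rewrite -addnS -[(size ts).+1]/K addnC -mulnS low_digit_mul.
Qed.

Hypothesis ts_prefix : forall y : outputs S,
  exists2 d, (d <= size ts)%N & wprod (take d ts) = fsval y.

Lemma tour_onto (w : seq (outputs S)) : exists n, tour n = wprod w.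
Proof.
elim/last_ind: w => [|w y [n IH]]; first by exists 0%N.
have [d ds dy] := ts_prefix y; exists (K * n + d)%N.
by rewrite tour_digit // IH dy -cats1 wprod_cat /= mulg1.
Qed.

End Traversal.

(** * Traversable graphs *)

Section Letters.
Local Open Scope group_scope.
Variables (G : groupType) (S : {fset G}).

(** Every letter is followed by its inverse, so that each prefix product is a
    single letter or 1 and the whole product is 1. *)
Definition excursions (s : seq (outputs S)) :=
  flatten [seq [:: y; inv_out y] | y <- s].

Lemma wprod_excursions s : wprod (excursions s) = 1.
Proof. by elim: s => //= y s ->; rewrite mulg1 mulgV. Qed.

Lemma excursions_prefix s y : y \in s ->
  exists2 d, (d <= size (excursions s))%N
    & wprod (take d (excursions s)) = fsval y.
Proof.
case/splitPr => s1 s2; exists (size (excursions s1)).+1.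
  by rewrite /excursions map_cat flatten_cat size_cat /= addnS ltnS leq_addr.
rewrite /excursions map_cat flatten_cat -addn1 takeD.
rewrite take_size_cat // drop_size_cat //=.
by rewrite ?take0 wprod_cat wprod_excursions /= mul1g mulg1.
Qed.

Lemma generates_words :
  generates S -> forall x, exists w : seq (outputs S), wprod w = x.
Proof.
move=> genS x; have : [set: G]%classic x by [].
rewrite -genS.
move/(_ [set x | exists w : seq (outputs S), wprod w = x]%classic).
apply; split.
  split.
- by exists [::].
- move=> _ _ [w <-] [w' <-]; elim/last_ind: w' => [|w' y IH] in w *.
    by exists w; rewrite invg1 mulg1.
  have [w1 E] := IH (rcons w (inv_out y)).
  exists w1; rewrite E -!cats1 !wprod_cat /= !mulg1.
  by rewrite invgM mulgA.
move=> y /= xS; have yS : y \in (sym_set S `|` [fset 1])%fset.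
  by rewrite !in_fsetU xS.
by exists [:: [` yS]%fset]; rewrite /= mulg1.
Qed.

Lemma infinite_order_traverses (genS : generates S) (g : G) :
  infinite_order g ->
  exists (m : nat) (C : collective S m)
       (q0 : forall i : 'I_m, states C i) (v0 : 'I_m -> G),
       (0 < m)%N /\ traverses q0 v0.
Proof.
move=> inf_g; have [gw gwE] := generates_words genS g.
have [gi giE] := generates_words genS g^-1.
pose ts := excursions (enum (outputs S)).
have ts_prefix (y : outputs S) :
    exists2 d, (d <= size ts)%N & wprod (take d ts) = fsval y.
  by apply: excursions_prefix; rewrite mem_enum.
have ts0 : (0 < size ts)%N.
  rewrite /ts; have : out1 S \in enum (outputs S) by rewrite mem_enum.
  by case: (enum _).
apply: (@machine_traverses _ _ _ (forever (body gw gi ts))) => x.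
have [w <-] := generates_words genS x.
have [n <-] := tour_onto ts0 (wprod_excursions _) ts_prefix w.
have [t E] := tour_visited inf_g gwE giE ts0 n.
by exists t; apply: E.
Qed.

Lemma finite_traverses : finite_set [set: G]%classic ->
  exists (m : nat) (C : collective S m)
       (q0 : forall i : 'I_m, states C i) (v0 : 'I_m -> G),
       (0 < m)%N /\ traverses q0 v0.
Proof.
move=> /finite_seqP[s sE].
have in_s x : x \in s by have : [set: G]%classic x by []; rewrite sE.
pose C := @Collective G S (size s) (fun=> unit : finType)
  (fun i => Automaton (fun q _ => q) (fun _ _ => out1 S)).
exists (size s), C, (fun=> tt), (fun i => nth 1 s i); split.
  by case: s in_s {sE C} => // /(_ 1).
move=> x; have xs : (index x s < size s)%N by rewrite index_mem.
by exists 0%N, (Ordinal xs); rewrite /= nth_index.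
Qed.

End Letters.

(** * The characterization *)

Theorem mainTheorem1 (G : groupType) (S : {fset G}) (genS : generates S) :
  (~ exists (m : nat) (C : collective S m)
       (q0 : forall i : 'I_m, states C i) (v0 : 'I_m -> G),
       0 < m /\ traverses q0 v0)
  <->
  (infinite_set [set: G]%classic /\ ~ exists g : G, infinite_order g).
Proof.
split=> [no|[infG torsion] [m [C [q0 [v0 [_ tr]]]]]].
  split; first by move=> finG; apply: no; apply: finite_traverses.
  by move=> [g inf_g]; apply: no; apply: infinite_order_traverses inf_g.
apply: infG; apply: traverses_finite tr => g; apply: contrapT => noexp.
apply: torsion; exists g => n n0 gn; apply: noexp; by exists n.
Qed.
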